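(* There are finite nilpotent groups of arbitrarily large nilpotency class admitting a unital cubic map from the cyclic group $C_3$ of order $3$ whose image generates the group. That is, for every $n\in\mathbb N$ there exist a finite nilpotent group $N$ of nilpotency class at least $n$ and a unital cubic map $\alpha\colon C_3\to N$ such that $\alpha(C_3)$ generates $N$.
   Context: Polynomial maps: for groups $G,H$, a map $\varphi\colon G\to H$ and $k\in G$, the finite difference is the map $(\Delta_k\varphi)(g):=\varphi(kg)\varphi(g)^{-1}$, $g\in G$. A map $\varphi$ is polynomial of degree $-1$ if it is identically $1$. For $d\ge -1$, $\varphi$ is polynomial of degree $d+1$ if $\Delta_k\varphi$ is polynomial of degree $d$ for every $k\in G$. A map is cubic if it is polynomial of degree at most $3$, and unital if $\varphi(1)=1$. *)

(* Defs.v *)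
From mathcomp Require Import all_boot all_order all_algebra all_fingroup all_solvable.

Set Implicit Arguments.
Unset Strict Implicit.
Unset Printing Implicit Defensive.

Local Open Scope group_scope.

Definition fin_diff (G H : groupType) (k : G) (phi : G -> H) : G -> H :=
  fun g => phi (k * g) * (phi g)^-1.

(* Degrees start at -1, so the index is shifted by one: [polynomial_map m phi]
   says that phi is polynomial of degree m - 1. *)
Fixpoint polynomial_map (G H : groupType) (m : nat) (phi : G -> H) : Prop :=
  match m with
  | 0 => forall g : G, phi g = 1
  | m'.+1 => forall k : G, polynomial_map m' (fin_diff k phi)
  end.

(* Degree at most 3, i.e. shifted degree at most 4. *)
Definition cubic (G H : groupType) (phi : G -> H) : Prop :=
  exists2 m : nat, m <= 4 & polynomial_map m phi.

Definition unital (G H : groupType) (phi : G -> H) : Prop := phi 1 = 1.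

(* The group law of 'Z_3, although written multiplicatively, is addition
   modulo 3; its identity 1%g is the residue 0. *)
Definition C3 : finGroupType := 'Z_3.

(* Main.v *)
Require Import Defs.
From mathcomp Require Import all_boot all_order all_algebra all_fingroup all_solvable.
From mathcomp Require Import ring.

(** The group [N] acts on [Z/9 x Z/q], [q = 3 ^ n.+1], and is generated by
    [a : (x, t) |-> (x + 1, t)] and [b : (x, t) |-> (4 x + 2, t + w x)], where
    [w] takes the values [1] at [4], [-1] at [1] and [0] elsewhere; the map
    [alpha] sends [0, 1, 2] to [1, a, b]. That [alpha] is cubic is a finite
    computation, which can be carried out with [Z] in place of [Z/q]. All
    elements of [N] have the form [(x, t) |-> ((1 + 3 e) x + c, t + f x)], so [N]
    is a 3-group of exponent dividing [9 q]. Put [s = b a^-2] and [r = a^3].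
    The iterated commutator [[s, r, ..., r]] is the translation
    [t |-> t + (D ^ j w') x] with [w' y = w (7 y)] and [D = U - 1], where [U], the
    shift by 3 on [Z/9], satisfies [U ^ 3 = 1]; hence [D ^ 3 = - 3 U D], and the
    commutator of length [2 n + 1] takes the value [(-3) ^ n <> 0]. *)

Set Implicit Arguments.
Unset Strict Implicit.
Unset Printing Implicit Defensive.

Import GRing.Theory.
Local Open Scope ring_scope.

(** For computing modulo 9 with [ring]: the witness [z] names the multiple of 9 by which the two
    sides differ. *)
Lemma eq_Z9 (z x y : 'Z_9) : x = y + 9 * z -> x = y.
Proof. by move->; rewrite [9](_ : _ = 0) ?mul0r ?addr0 //; apply/val_inj. Qed.

Section Steps.
Variable M : nzRingType.

(** [M] will be ['Z_q] for the group and [int] for the computation. *)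
Definition weight (x : 'Z_9) : M := (x == 4)%:R - (x == 1)%:R.

Definition shift (u : 'Z_9 * M) : 'Z_9 * M := (u.1 + 1, u.2).
Definition shiftV (u : 'Z_9 * M) : 'Z_9 * M := (u.1 - 1, u.2).
Definition twist (u : 'Z_9 * M) : 'Z_9 * M := (4 * u.1 + 2, u.2 + weight u.1).
(** Modulo 9, 7 is the inverse of 4, and [- 7 * 2 = 4]. *)
Definition twistV (u : 'Z_9 * M) : 'Z_9 * M :=
  (7 * u.1 + 4, u.2 - weight (7 * u.1 + 4)).

Lemma shiftK : cancel shift shiftV.
Proof. by case=> x t; rewrite /shiftV /= addrK. Qed.

Lemma twistK : cancel twist twistV.
Proof.
case=> x t; rewrite /twistV /=.
have -> : 7 * (4 * x + 2) + 4 = x by apply: (@eq_Z9 (3 * x + 2)); ring.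
by rewrite addrK.
Qed.

Lemma twistVK : cancel twistV twist.
Proof.
case=> x t; rewrite /twist /= subrK; congr (_, _).
by apply: (@eq_Z9 (3 * x + 2)); ring.
Qed.

End Steps.

Section Group.
Variable q : nat.
Local Notation X := ('Z_9 * 'Z_q)%type.

(** * Cubicity of the generating map *)

Definition shift_perm : {perm X} := perm (can_inj (@shiftK 'Z_q)).
Definition twist_perm : {perm X} := perm (can_inj (@twistK 'Z_q)).

(** As [t] is arbitrary, the values of [d] at [z = 0] already determine [s]. *)
Definition tracks (s : {perm X}) (d : 'Z_9 * int -> 'Z_9 * int) : Prop :=
  forall x z t, s (x, t + z%:~R) = ((d (x, z)).1, t + (d (x, z)).2%:~R).

Lemma tracksM s s' d d' :
  tracks s d -> tracks s' d' -> tracks (s * s')%g (d' \o d).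
Proof.
by move=> sd sd' x z t; rewrite permM sd /=; case: (d (x, z)) => y w; exact: sd'.
Qed.

Lemma weight_intr x : (weight int x)%:~R = weight 'Z_q x.
Proof. by rewrite /weight rmorphB /= !rmorph_nat. Qed.

Lemma tracks_id : tracks 1%g id.
Proof. by move=> x z t; rewrite perm1. Qed.

Lemma tracks_shift : tracks shift_perm (@shift int).
Proof. by move=> x z t; rewrite permE. Qed.

Lemma tracks_twist : tracks twist_perm (@twist int).
Proof.
by move=> x z t; rewrite permE /twist /= rmorphD /= weight_intr -!addrA.
Qed.

Lemma tracks_shiftV : tracks shift_perm^-1%g (@shiftV int).
Proof.
move=> x z t; apply: (@perm_inj _ shift_perm); rewrite permKV permE.
by rewrite /shift /= subrK.
Qed.

Lemma tracks_twistV : tracks twist_perm^-1%g (@twistV int).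
Proof.
move=> x z t; apply: (@perm_inj _ twist_perm); rewrite permKV permE.
rewrite /twistV /= rmorphB /= weight_intr [t + (_ - _)]addrA.
by rewrite -[LHS](twistVK (x, t + z%:~R)).
Qed.

Definition C3_elements : seq C3 := [:: inZp 0; inZp 1; inZp 2].

(* [d g] and [e g] model a permutation [phi g] and its inverse, so that finite
   differences can be evaluated by computation. *)
Fixpoint vanishes (m : nat) (d e : C3 -> 'Z_9 * int -> 'Z_9 * int) : bool :=
  if m is m'.+1 then
    all (fun k => vanishes m' (fun g => e g \o d (k * g)%g)
                              (fun g => e (k * g)%g \o d g)) C3_elements
  else
    all (fun g => all (fun i => d g (inZp i, 0) == (inZp i, 0)) (iota 0 9))
      C3_elements.

Lemma mem_C3 (g : C3) : g \in C3_elements.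
Proof. by case: g => [[|[|[]]]]. Qed.

Lemma tracks_polynomial m (phi : C3 -> {perm X}) d e :
    (forall g, tracks (phi g) (d g)) -> (forall g, tracks (phi g)^-1%g (e g)) ->
  vanishes m d e -> polynomial_map m phi.
Proof.
elim: m phi d e => [|m IHm] phi d e phid phie /allP van.
  move=> g; apply/permP => -[x t]; rewrite perm1.
  have x9 : nat_of_ord x \in iota 0 9 by rewrite mem_iota ltn_ord.
  have /eqP := allP (van g (mem_C3 g)) _ x9; rewrite valZpK => dx.
  by have := phid g x 0 t; rewrite dx /= addr0.
move=> k; apply: IHm (van k (mem_C3 k)) => g; first exact: tracksM.
by rewrite /fin_diff invMg invgK; apply: tracksM.
Qed.

Definition cubic_map (g : C3) : {perm X} :=
  nth 1%g [:: 1; shift_perm; twist_perm]%g (nat_of_ord (g : 'Z_3)).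

Lemma cubic_map_cubic : polynomial_map 4 cubic_map.
Proof.
pose d (g : C3) := nth id [:: id; @shift int; @twist int] (nat_of_ord (g : 'Z_3)).
pose e (g : C3) := nth id [:: id; @shiftV int; @twistV int] (nat_of_ord (g : 'Z_3)).
apply: (@tracks_polynomial _ _ d e) => [[[|[|[]]] //]|[[|[|[]]] //]|].
- by move=> ?; apply: tracks_id.
- by move=> ?; apply: tracks_shift.
- by move=> ?; apply: tracks_twist.
- by move=> ?; rewrite /cubic_map invg1; apply: tracks_id.
- by move=> ?; apply: tracks_shiftV.
- by move=> ?; apply: tracks_twistV.
(* All 81 fourfold differences are evaluated over the integers, uniformly in [q]. *)
by vm_compute.
Qed.

(** * Normal form of the group elements, and their exponent *)

Definition triangular (e w : 'Z_9) (f : 'Z_9 -> 'Z_q) (s : {perm X}) : Prop :=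
  forall x t, s (x, t) = ((1 + 3 * e) * x + w, t + f x).

(** The slopes [1 + 3 * e] multiply as the [e] add, because [9 * e * e'] vanishes. *)
Lemma triangularM e w f s e' w' f' s' :
    triangular e w f s -> triangular e' w' f' s' ->
  triangular (e + e') ((1 + 3 * e') * w + w')
    (fun x => f x + f' ((1 + 3 * e) * x + w)) (s * s')%g.
Proof.
move=> sE s'E x t; rewrite permM sE s'E; congr (_, _); last by rewrite addrA.
by apply: (@eq_Z9 (e * e' * x)); ring.
Qed.

Lemma triangular_cube e w f s :
  triangular e w f s -> exists f', triangular 0 (3 * w) f' (s ^+ 3)%g.
Proof.
move=> sE; have [f' s3E] : exists f', triangular (e + (e + e))
    ((1 + 3 * (e + e)) * w + ((1 + 3 * e) * w + w)) f' (s ^+ 3)%g.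
  by eexists; rewrite !expgS expg0 mulg1; apply: triangularM (triangularM _ _).
exists f' => x t; rewrite s3E; congr (_, _).
by apply: (@eq_Z9 (e * x + e * w)); ring.
Qed.

Lemma triangular_expg f s n :
  triangular 0 0 f s -> triangular 0 0 (fun x => f x *+ n) (s ^+ n)%g.
Proof.
move=> sE; elim: n => [|n IHn] x t.
  by rewrite expg0 perm1 mulr0n !addr0 mulr0 addr0 mul1r.
rewrite expgS permM sE IHn !mulr0 !addr0 !mul1r mulrS; congr (_, _); ring.
Qed.

(** Each cubing kills [e] and triples [w], so the ninth power only adds to [t] an amount depending
    on [x], and its [q]-th power is trivial. *)
Lemma triangular_exponent e w f s :
  (1 < q)%N -> triangular e w f s -> (s ^+ (3 * 3 * q) = 1)%g.
Proof.
move=> q_gt1 /triangular_cube[f1 /triangular_cube[f2 s9E]].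
have {}s9E : triangular 0 0 f2 (s ^+ (3 * 3))%g.
  by move=> x t; rewrite expgM s9E; congr (_, _); apply: (@eq_Z9 w); ring.
have fq x : f2 x *+ q = 0 by rewrite -mulr_natr pchar_Zp ?mulr0.
apply/permP => -[x t]; rewrite expgM (triangular_expg q s9E) perm1 fq.
by rewrite mulr0 !addr0 mul1r.
Qed.

Lemma triangular1 : triangular 0 0 (fun=> 0) 1%g.
Proof. by move=> x t; rewrite perm1 mulr0 !addr0 mul1r. Qed.

Lemma triangular_shift : triangular 0 1 (fun=> 0) shift_perm.
Proof. by move=> x t; rewrite permE mulr0 !addr0 mul1r. Qed.

Lemma triangular_twist : triangular 1 2 (weight 'Z_q) twist_perm.
Proof. by move=> x t; rewrite permE /twist; congr (_ * _ + _, _); ring. Qed.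

Definition cubic_group : {group {perm X}} := [group of <<cubic_map @: [set: C3]>>%g].

Lemma cubic_group_triangular s :
  s \in cubic_group -> exists e w f, triangular e w f s.
Proof.
case/gen_prodgP => n [c cA ->].
apply: (big_ind (fun s => exists e w f, triangular e w f s)).
- by exists 0, 0, (fun=> 0); apply: triangular1.
- move=> s1 s2 [e1 [w1 [f1 s1E]]] [e2 [w2 [f2 s2E]]].
  by do 3!eexists; apply: triangularM s1E s2E.
move=> i _; have /imsetP[g _ ->] := cA i.
rewrite /cubic_map; case: (nat_of_ord g) => [|[|[|k]]] /=.
- by exists 0, 0, (fun=> 0); apply: triangular1.
- by exists 0, 1, (fun=> 0); apply: triangular_shift.
- by exists 1, 2, (weight 'Z_q); apply: triangular_twist.
- by rewrite nth_nil; exists 0, 0, (fun=> 0); apply: triangular1.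
Qed.

Lemma cubic_group_pgroup n : q = (3 ^ n.+1)%N -> (3.-group cubic_group)%g.
Proof.
move=> qE; rewrite -pnat_exponent.
have q_gt1 : (1 < q)%N by rewrite qE -(expn0 3) ltn_exp2l.
apply: (@pnat_dvd _ (3 * 3 * q)); last by rewrite qE !pnatM pnatX.
apply/exponentP => s /cubic_group_triangular[e [w [f]]].
exact: triangular_exponent.
Qed.

(** * Iterated commutators *)

Definition backdiff (F : 'Z_9 -> 'Z_q) (x : 'Z_9) : 'Z_q := F (x - 3) - F x.

(** Expand [(U - 1)^3] with [U^3 = 1]. *)
Lemma backdiff3 F x : backdiff (backdiff (backdiff F)) x = - 3 * backdiff F (x - 3).
Proof.
rewrite /backdiff; have -> : x - 3 - 3 - 3 = x by apply: (@eq_Z9 (-1)); ring.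
by ring.
Qed.

(** By [v * 3 = 3], multiplication by [v] commutes with the shift by 3. Evaluating [F] at the image
    [v * x] makes [v] drop out of the commutator. *)
Lemma commg_shift3 (c : {perm X}) v F :
    v * 3 = 3 -> (forall x t, c (x, t) = (v * x, t + F (v * x))) ->
  forall x t, [~ c, shift_perm ^+ 3]%g (x, t) = (x, t + backdiff F x).
Proof.
move=> v3 cE x t; set r := (shift_perm ^+ 3)%g.
have rE y u : r (y, u) = (y + 3, u).
  by rewrite /r !expgS expg0 mulg1 !permM !permE /shift /=; congr (_, _); ring.
have rVE y u : r^-1%g (y, u) = (y - 3, u).
  by apply: (@perm_inj _ r); rewrite permKV rE subrK.
case def_y: (c^-1%g (x, t)) => [y u].
have := cE y u; rewrite -def_y permKV => -[xE tE].
clearbody r; rewrite commgEl conjgE !permM def_y rVE cE rE mulrBr v3 -xE subrK.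
by rewrite /backdiff tE -xE; congr (_, _); ring.
Qed.

(** The element [s] sends the coordinate [x] to [y = 4 * x], and [7 * y] recovers [x]. *)
Definition profile (y : 'Z_9) : 'Z_q := weight _ (7 * y).

Definition iter_comm (j : nat) : {perm X} :=
  iter j (fun c => [~ c, shift_perm ^+ 3]%g) (twist_perm * shift_perm ^- 2)%g.

(** The factor [v] is 4 for [j = 0] and 1 afterwards. *)
Lemma iter_commE j : exists2 v, v * 3 = 3 & forall x t,
  iter_comm j (x, t) =
    (v * x, t + iter j backdiff profile (v * x)).
Proof.
elim: j => [|j [v v3 cE]]; last first.
  exists 1; first by rewrite mul1r.
  by move=> x t; rewrite mul1r; apply: (commg_shift3 v3 cE).
exists 4 => [|x t]; first exact/val_inj.
rewrite /iter_comm /=; set r := (shift_perm ^+ 2)%g.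
have rE y u : r (y, u) = (y + 2, u).
  by rewrite /r !expgS expg0 mulg1 permM !permE /shift /=; congr (_, _); ring.
clearbody r; apply: (@perm_inj _ r).
rewrite permM permKV rE permE /twist /profile /=.
by congr (_, _ + weight _ _); apply: (@eq_Z9 (- 3 * x)); ring.
Qed.

Lemma iter_commSE j x t :
  iter_comm j.+1 (x, t) =
    (x, t + iter j.+1 backdiff profile x).
Proof. by have [v v3 cE] := iter_commE j; apply: commg_shift3 v3 cE x t. Qed.

(** The evaluation point advances by 3 with [m] to absorb the shift to [x - 3] in [backdiff3]. *)
Lemma iter_backdiffE m :
  iter m.*2.+1 backdiff profile (4 + 3 * m%:R) = (- 3) ^+ m.
Proof.
elim: m => [|m IHm].
  (* The base value is [profile 1 - profile 4 = 0 - (- 1) = 1]. *)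
  have p1 : profile (4 - 3) = 0 by exact: (subrr (0 : 'Z_q)).
  have p4 : profile 4 = - 1 by exact: (sub0r (1 : 'Z_q)).
  by rewrite /= /backdiff mulr0 addr0 p1 p4 opprK add0r.
rewrite doubleS [LHS]backdiff3 exprS -IHm; congr (_ * backdiff _ _).
by rewrite -natr1; ring.
Qed.

Lemma iter_comm_lcn j : iter_comm j \in 'L_j.+1(cubic_group)%g.
Proof.
have genA g : cubic_map g \in cubic_group by apply/mem_gen/imset_f/in_setT.
have shiftG : shift_perm \in cubic_group by exact: (genA (inZp 1 : 'Z_3)).
have twistG : twist_perm \in cubic_group by exact: (genA (inZp 2 : 'Z_3)).
elim: j => [|j IHj]; first by rewrite lcn1 groupM ?groupV ?groupX.
by rewrite lcnSn mem_commg ?groupX.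
Qed.

End Group.

(** At [x = 4 + 3 * n] the commutator adds [(- 3) ^ n] to [t]. Up to sign this is [3 ^ n], and
    [0 < 3 ^ n < q]. *)
Lemma iter_comm_neq1 n : iter_comm (3 ^ n.+1) n.*2.+1 != 1%g.
Proof.
set q := (3 ^ n.+1)%N; apply/eqP => c1.
have q_gt1 : (1 < q)%N by rewrite /q -(expn0 3) ltn_exp2l.
have := iter_commSE n.*2 (4 + 3 * n%:R) (0 : 'Z_q).
rewrite c1 perm1 iter_backdiffE add0r => -[/esym pow0].
have : (3 ^ n)%:R = 0 :> 'Z_q by rewrite natrX -[3]opprK exprNn pow0 mulr0.
move/(congr1 (@nat_of_ord _)); rewrite val_Zp_nat // modn_small ?ltn_exp2l //=.
by apply/eqP; rewrite -lt0n expn_gt0.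
Qed.

(** This carries cubicity from all permutations down to the subgroup. Taking [psi] only pointwise
    equal to [f \o phi] lets the induction pass to differences without function extensionality. *)
Lemma polynomial_map_inj (G H K : groupType) m (f : H -> K) (phi : G -> H)
    (psi : G -> K) :
    {morph f : x y / x * y >-> x * y}%g -> injective f -> f \o phi =1 psi ->
  polynomial_map m psi -> polynomial_map m phi.
Proof.
move=> fM f_inj.
have f1 : f 1%g = 1%g by apply: (mulgI (f 1%g)); rewrite -fM !mulg1.
have fV x : f x^-1%g = (f x)^-1%g by apply: (mulgI (f x)); rewrite -fM !mulgV.
elim: m phi psi => [|m IHm] phi psi fphi psiP.
  by move=> g; apply: f_inj; rewrite f1 -(psiP g) -fphi.
move=> k; apply: IHm (psiP k) => g.
by rewrite /= /fin_diff fM fV -!fphi.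
Qed.

Local Close Scope ring_scope.

Theorem corollary3 (n : nat) :
  exists (N : finGroupType) (alpha : C3 -> N),
    [/\ nilpotent [set: N],
        n <= nil_class [set: N],
        unital alpha,
        cubic alpha
      & <<alpha @: [set: C3]>>%g = [set: N]].
Proof.
pose q := (3 ^ n.+1)%N; pose G := cubic_group q.
have GA g : cubic_map q g \in G by apply/mem_gen/imset_f/in_setT.
have nilG : nilpotent G := pgroup_nil (cubic_group_pgroup (erefl q)).
exists (subg_of G), (fun g => subg G (cubic_map q g)); split.
- by rewrite -(isog_nil (isog_subg G)).
- rewrite -(isog_nil_class (isog_subg G)) leqNgt; apply/negP => cl_lt.
  (* A class below [n] would make the term of index [2 n + 2] of the lower central series trivial,
     but it contains the commutator of length [2 n + 1]. *)
  have /(lcn_nil_classP _ nilG) L1 : (nil_class G <= n.*2.+1)%N.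
    by rewrite (leq_trans (ltnW cl_lt)) // -addnn -addnS leq_addr.
  have := iter_comm_lcn q n.*2.+1; rewrite L1 inE; apply/negP.
  exact: iter_comm_neq1.
- exact: (morph1 (subg G)).
- exists 4 => //; apply: (polynomial_map_inj (f := sgval)) (cubic_map_cubic q) => //.
  + exact: subg_inj.
  + by move=> g; rewrite /= subgK.
have AG : cubic_map q @: [set: C3] \subset G by apply: subset_gen.
rewrite imset_comp -(morphimEsub (subg G)) // -morphim_gen //.
exact: im_subg.
Qed.
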